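(* Let $G$ be a finite group, $p$ a prime, and let $\Delta_1,\Delta_2$ be weak synthetic buildings for $G$ at $p$. Then $\Delta_1\times\Delta_2$ is a weak synthetic building for $G$ with the diagonal action. Thus $\mathrm{SB}(\Delta_1\times\Delta_2)$ is a synthetic building for $G$, and this provides a (well-defined) associative binary operation on $G$-equivariant homotopy classes of synthetic buildings for $G$. If $G$ has order divisible by $p$, the trivial synthetic building (a single point) acts as the identity for this operation.
   Context: A $G$-simplicial complex is a finite (possibly empty) simplicial complex $\Delta$ with a simplicial action of the finite group $G$ such that the setwise stabilizer of each simplex fixes that simplex pointwise. For $H\le G$, $\Delta^H$ denotes the fixed point subcomplex. Contractible spaces are non-empty. A $G$-simplicial complex $\Delta$ is a weak synthetic building for $G$ at the prime $p$ if (1) $\Delta^P$ is $N_G(P)$-equivariantly contractible for every non-identity $p$-subgroup $P\le G$; it is a synthetic building if in addition (2) the stabilizer of every simplex has order divisible by $p$. For a weak synthetic building $\Delta$, $\mathrm{SB}(\Delta)$ is the subcomplex consisting of the simplices of $\Delta$ whose stabilizers in $G$ have order divisible by $p$. For $G$-simplicial complexes $\Delta_1,\Delta_2$, let $\mathcal P(\Delta_i)$ be the poset of (non-empty) simplices of $\Delta_i$ ordered by inclusion. The notation $\Delta_1\times\Delta_2$ denotes the order complex of the product poset $\mathcal P(\Delta_1)\times\mathcal P(\Delta_2)$ (a triangulation of the product space), with the diagonal action of $G$. *)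

(* Defs.v *)
From HB Require Import structures.
(* The finite-set library is imported last: its names (set0, setX, setIP, ...)
   take precedence over the homonyms of classical_sets. *)
From mathcomp Require Import boolp classical_sets functions.
From mathcomp Require Import reals topology.
From mathcomp Require Import all_boot all_order all_algebra all_fingroup.
From mathcomp Require Import pgroup.

Set Implicit Arguments.
Unset Strict Implicit.
Unset Printing Implicit Defensive.

Import Order.TTheory GRing.Theory Num.Theory.
Import numFieldTopology.Exports.

(* Finite G-simplicial complexes.  The simplices are the elements of
   [gc_simp], all non-empty; the vertices of the complex are the v such that
   [set v] is a simplex.  The finite type [gc_vert] may have further elements:
   they play no role, and subcomplexes can be formed without changing it.
   As everywhere in MathComp, groups act on the right. *)
Section Complexes.
Local Open Scope group_scope.

(* In gc_simp_stab, 'N_G(s | _) is the setwise and 'C_G(s | _) the pointwise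
   stabilizer of s. *)
Record gcomplex (gT : finGroupType) (G : {group gT}) := GComplex {
  gc_vert : finType;
  gc_simp : {set {set gc_vert}};
  gc_act : action G gc_vert;
  gc_simp_neq0 : forall s, s \in gc_simp -> s != set0;
  gc_simp_sub : forall s t : {set gc_vert},
    s \in gc_simp -> t != set0 -> t \subset s -> t \in gc_simp;
  gc_simp_act : forall s a,
    s \in gc_simp -> a \in G -> (gc_act^*)%act s a \in gc_simp;
  gc_simp_stab : forall s, s \in gc_simp ->
    'N_G(s | gc_act) \subset 'C_G(s | gc_act)
}.

Variables (gT : finGroupType) (G : {group gT}).

Section Point.

Let triv (v : unit) (a : gT) := v.

Lemma triv_is_action : is_action G triv.
Proof. by split=> [a v w | v a b]. Qed.

Let S : {set {set unit}} := [set [set: unit]].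

Fact point_neq0 s : s \in S -> s != set0.
Proof. by move/set1P->; apply/set0Pn; exists tt; rewrite inE. Qed.

Fact point_sub (s t : {set unit}) :
  s \in S -> t != set0 -> t \subset s -> t \in S.
Proof.
move=> _ /set0Pn[[] t_tt] _; apply/set1P/setP=> -[].
by rewrite t_tt inE.
Qed.

Fact point_act s a :
  s \in S -> a \in G -> ((Action triv_is_action)^*)%act s a \in S.
Proof.
move/set1P-> => _; apply/set1P/setP=> -[]; rewrite inE.
by apply/imsetP; exists tt; rewrite ?inE.
Qed.

Fact point_stab s : s \in S ->
  'N_G(s | Action triv_is_action) \subset 'C_G(s | Action triv_is_action).
Proof.
move=> _; apply/subsetP=> a /setIP[Ga _]; rewrite !inE Ga /=.
by apply/subsetP=> v _; rewrite inE.
Qed.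

Definition gpoint : gcomplex G :=
  GComplex point_neq0 point_sub point_act point_stab.

End Point.

Section FixedSubcomplex.

Variables (D : gcomplex G) (P : {group gT}) (sPG : P \subset G).

Definition fix_simp := [set s in gc_simp D | s \subset 'Fix_(gc_act D)(P)].

Definition fix_act := (gc_act D \ subsetIl G 'N(P))%act.

Fact fix_neq0 s : s \in fix_simp -> s != set0.
Proof. by case/setIdP=> /gc_simp_neq0. Qed.

Fact fix_sub (s t : {set gc_vert D}) :
  s \in fix_simp -> t != set0 -> t \subset s -> t \in fix_simp.
Proof.
case/setIdP=> Ds fixs t0 sts; rewrite inE (gc_simp_sub Ds t0 sts).
exact: subset_trans sts fixs.
Qed.

Fact fix_simp_act s a :
  s \in fix_simp -> a \in 'N_G(P) -> (fix_act^*)%act s a \in fix_simp.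
Proof.
case/setIdP=> Ds /subsetP fixs /setIP[Ga nPa].
have -> : (fix_act^*)%act s a = ((gc_act D)^*)%act s a by [].
rewrite inE gc_simp_act //=; apply/subsetP=> _ /imsetP[v sv ->].
apply/afixP=> b Pb; have Gb := subsetP sPG b Pb.
have Pc : b ^ a^-1 \in P by rewrite memJ_norm ?groupV.
have /afixP/(_ _ Pc) fv := fixs v sv.
by rewrite -actMin // conjgCV actMin ?(subsetP sPG _ Pc) // fv.
Qed.

Fact fix_stab s : s \in fix_simp ->
  'N_('N_G(P))(s | fix_act) \subset 'C_('N_G(P))(s | fix_act).
Proof.
case/setIdP=> /gc_simp_stab/subsetP Dstab _; apply/subsetP=> a.
rewrite astabs_ract astab_ract => /setIP[NPa /setIP[_ Na]].
have /setIP[Ga _] := NPa.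
have /setIP[_ Ca] : a \in 'C_G(s | gc_act D) by apply/Dstab/setIP.
by apply/setIP; split=> //; apply/setIP.
Qed.

Definition fixc : gcomplex 'N_G(P)%G :=
  @GComplex _ 'N_G(P)%G _ _ _ fix_neq0 fix_sub fix_simp_act fix_stab.

End FixedSubcomplex.

Section Product.

Variables D1 D2 : gcomplex G.

Let W : finType := ({set gc_vert D1} * {set gc_vert D2})%type.

Definition prod_le (u v : W) := (u.1 \subset v.1) && (u.2 \subset v.2).

(* The non-empty chains of the product of the two posets of simplices. *)
Definition prod_simp : {set {set W}} :=
  [set C : {set W} | [&& C != set0, C \subset setX (gc_simp D1) (gc_simp D2)
    & [forall u in C, forall v in C, prod_le u v || prod_le v u]]].

Definition prod_actf (u : W) a : W :=
  (((gc_act D1)^*)%act u.1 a, ((gc_act D2)^*)%act u.2 a).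

Lemma prod_is_action : is_action G prod_actf.
Proof.
split=> [a [s t] [s' t'] [/act_inj-> /act_inj->] // | [s t] a b Ga Gb].
by rewrite /prod_actf /= !actMin.
Qed.

Definition prod_act := Action prod_is_action.

Fact prod_neq0 C : C \in prod_simp -> C != set0.
Proof. by rewrite inE => /and3P[]. Qed.

Fact prod_sub (C C' : {set W}) :
  C \in prod_simp -> C' != set0 -> C' \subset C -> C' \in prod_simp.
Proof.
rewrite !inE => /and3P[_ sC chC] -> sC'C; rewrite (subset_trans sC'C sC) /=.
apply/forall_inP=> u /(subsetP sC'C) Cu.
apply/forall_inP=> v /(subsetP sC'C) Cv.
exact: (forall_inP (forall_inP chC u Cu) v Cv).
Qed.

Fact prod_le_act u v a : prod_le u v -> prod_le (prod_actf u a) (prod_actf v a).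
Proof. by case/andP=> s1 s2; rewrite /prod_le /= !imsetS. Qed.

Fact prod_simp_act C a :
  C \in prod_simp -> a \in G -> (prod_act^*)%act C a \in prod_simp.
Proof.
rewrite !inE -!card_gt0 card_setact => /and3P[-> /subsetP sC chC] Ga /=.
apply/andP; split.
  apply/subsetP=> _ /imsetP[u /sC Cu ->]; move: Cu; rewrite !inE /=.
  by case/andP=> s1 s2; rewrite !gc_simp_act.
apply/forall_inP=> _ /imsetP[u Cu ->]; apply/forall_inP=> _ /imsetP[v Cv ->].
by case/orP: (forall_inP (forall_inP chC u Cu) v Cv) => /(prod_le_act a)->;
  rewrite ?orbT.
Qed.

Fact prod_le_card u v : prod_le u v ->
  (#|u.1| + #|u.2| = #|v.1| + #|v.2|)%N -> u = v.
Proof.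
case: u v => [s t] [s' t'] /andP[/= sss' stt'] eqc.
have le1 := subset_leq_card sss'; have le2 := subset_leq_card stt'.
have e1 : #|s'| <= #|s| by rewrite -(leq_add2r #|t|) eqc leq_add2l.
have e2 : #|t'| <= #|t| by rewrite -(leq_add2l #|s|) eqc leq_add2r.
by congr (_, _); apply/eqP; rewrite eqEcard ?sss' ?stt'.
Qed.

Fact prod_stab C : C \in prod_simp ->
  'N_G(C | prod_act) \subset 'C_G(C | prod_act).
Proof.
rewrite inE => /and3P[_ _ chC]; apply/subsetP=> a /setIP[Ga nCa].
rewrite !inE Ga /=; apply/subsetP=> u Cu; rewrite inE; apply/eqP.
have Cua : prod_act u a \in C by rewrite (astabs_act _ nCa).
have cua : #|(prod_act u a).1| + #|(prod_act u a).2| = #|u.1| + #|u.2|.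
  by rewrite !card_setact.
case/orP: (forall_inP (forall_inP chC u Cu) _ Cua) => le.
  exact: esym (prod_le_card le (esym cua)).
exact: (prod_le_card le cua).
Qed.

Definition prodc : gcomplex G :=
  GComplex prod_neq0 prod_sub prod_simp_act prod_stab.

End Product.

Section SyntheticPart.

Variables (p : nat) (D : gcomplex G).

Definition SB_simp := [set s in gc_simp D | p %| #|'N_G(s | gc_act D)| ].

Fact SB_neq0 s : s \in SB_simp -> s != set0.
Proof. by case/setIdP=> /gc_simp_neq0. Qed.

Fact SB_sub (s t : {set gc_vert D}) :
  s \in SB_simp -> t != set0 -> t \subset s -> t \in SB_simp.
Proof.
case/setIdP=> Ds p_s t0 sts; rewrite inE (gc_simp_sub Ds t0 sts) /=.
apply: dvdn_trans p_s (cardSg _); apply: subset_trans (gc_simp_stab Ds) _.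
apply: setIS; apply: subset_trans (astabS _ sts) _; exact: astab_sub.
Qed.

Fact SB_act s a :
  s \in SB_simp -> a \in G -> ((gc_act D)^*)%act s a \in SB_simp.
Proof.
case/setIdP=> Ds p_s Ga; rewrite inE gc_simp_act //=.
have eqNC u : u \in gc_simp D -> 'N_G(u | gc_act D) = 'C_G(u | gc_act D).
  by move=> Du; apply/eqP; rewrite eqEsubset gc_simp_stab //= setIS ?astab_sub.
rewrite eqNC ?gc_simp_act // astab_setact_in // -{1}(conjGid Ga) -conjIg.
by rewrite cardJg -eqNC.
Qed.

Fact SB_stab s : s \in SB_simp ->
  'N_G(s | gc_act D) \subset 'C_G(s | gc_act D).
Proof. by case/setIdP=> /gc_simp_stab. Qed.

Definition SB : gcomplex G := GComplex SB_neq0 SB_sub SB_act SB_stab.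

End SyntheticPart.
End Complexes.

Section Realization.
Local Open Scope classical_set_scope.
Local Open Scope ring_scope.

Variables (R : realType) (gT : finGroupType) (G : {group gT}).
Implicit Types D E : gcomplex G.

(* Barycentric coordinates on the vertices; as gc_vert D is finite, the
   pointwise topology is the Euclidean one. *)
Definition gpoints D := {ptws gc_vert D -> R}.

Definition realization D : set (gpoints D) :=
  [set x | [/\ forall v, 0 <= x v, \sum_v x v = 1
             & finset (fun v => x v != 0) \in gc_simp D]].
Arguments realization D x : clear implicits.

(* The point x moved by a: a vertex v has in x the weight that v a has in
   [realact x a]. *)
Definition realact D (x : gpoints D) (a : gT) : gpoints D :=
  fun v => x (gc_act D v a^-1%g).

Definition gmap D E (f : gpoints D -> gpoints E) : Prop :=
  [/\ {within realization D, continuous f},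
      forall x, realization D x -> realization E (f x)
    & forall x a, realization D x -> a \in G ->
        f (realact x a) = realact (f x) a].

Definition ghomotopic D E (f g : gpoints D -> gpoints E) : Prop :=
  exists H : gpoints D * R -> gpoints E,
  [/\ {within realization D `*` `[0, 1], continuous H},
      forall t, 0 <= t <= 1 -> gmap (fun x => H (x, t)),
      forall x, realization D x -> H (x, 0) = f x
    & forall x, realization D x -> H (x, 1) = g x].

Definition ghequiv D E : Prop :=
  exists (f : gpoints D -> gpoints E) (g : gpoints E -> gpoints D),
  [/\ gmap f, gmap g, ghomotopic (g \o f) id & ghomotopic (f \o g) id].

Definition gcontractible D : Prop := ghequiv D (gpoint G).

End Realization.
Arguments realization R {gT G} D x.

Section SyntheticBuildings.
Local Open Scope group_scope.

Variables (R : realType) (p : nat) (gT : finGroupType) (G : {group gT}).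

Definition weak_synthetic (D : gcomplex G) : Prop :=
  forall (P : {group gT}) (sPG : P \subset G),
  p.-group P -> P :!=: 1 -> gcontractible R (fixc D sPG).

Definition synthetic (D : gcomplex G) : Prop :=
  weak_synthetic D /\
  forall s, s \in gc_simp D -> p %| #|'N_G(s | gc_act D)|.

(* A G-homotopy class of synthetic buildings, as a collection of complexes.
   Plain predicates are used because gcomplex G is too large a type to carry
   the [set] of classical_sets. *)
Record shclass := ShClass {
  sh_mem :> gcomplex G -> Prop;
  shclassP : exists2 D, synthetic D &
    forall E, sh_mem E <-> synthetic E /\ ghequiv R D E
}.

End SyntheticBuildings.

(* Main.v *)
Require Import Defs.
From mathcomp Require Import boolp classical_sets functions.
From mathcomp Require Import reals topology normedtype.
From mathcomp Require Import all_boot all_order all_algebra all_fingroup.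
From mathcomp Require Import pgroup cyclic lra.

(* The realization of D1 x D2 is G-homotopy equivalent to |D1| x |D2|.  From
   left to right, a vertex (s, t) with weight x spreads x over the vertices of
   s and of t, and the two results are normalized to have sum 1.  From right to
   left, (a, b) is rescaled so that a and b both have maximum 1, and (s, t) gets
   a weight that is positive exactly when s and t are the superlevel sets
   {a > r} and {b > r} for a common r >= 0; such pairs form a chain.  The two
   composites do not enlarge supports, so straight lines join them to the
   identities.

   A point of |D| lies in |SB D| exactly when it is fixed by an element of order
   p of G (Cauchy); write X_p for the set of such points of a G-space X.  G-maps
   preserve it, so SB respects G-homotopy equivalence, and the points of (|D1|_p x |D2|)_p are those of
   (|D1| x |D2|)_p; associativity and the identity are thereby inherited from
   the product of G-spaces.  Finally (D1 x D2)^P = D1^P x D2^P, a product of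
   contractible spaces. *)

Set Implicit Arguments.
Unset Strict Implicit.
Unset Printing Implicit Defensive.

Import Order.TTheory GRing.Theory Num.Theory.
Import numFieldTopology.Exports numFieldNormedType.Exports.

(** * Continuity relative to a subset, and gluing along a level set of a real function *)

Section ContinuousOn.
Local Open Scope classical_set_scope.
Local Open Scope ring_scope.

(** Stated as limits along [within A (nbhs x)], so that composition, pairing and arithmetic reduce
    to filter lemmas without changing the topology of the domain. *)
Definition cont_on (X Y : topologicalType) (A : set X) (f : X -> Y) :=
  forall x, A x -> f @ within A (nbhs x) --> f x.

Lemma cont_onP (X Y : topologicalType) (A : set X) (f : X -> Y) :
  {within A, continuous f} <-> cont_on A f.
Proof. exact: subspace_continuousP. Qed.

Lemma cont_on_comp (X Y Z : topologicalType) (A : set X) (B : set Y)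
    (f : X -> Y) (g : Y -> Z) :
  cont_on A f -> (forall x, A x -> B (f x)) -> cont_on B g ->
  cont_on A (fun x => g (f x)).
Proof.
move=> cf fAB cg x Ax; apply: cvg_trans (cg _ (fAB _ Ax)) => U /= nU.
by have := cf x Ax _ nU; apply: filterS2 (withinT _ _) => y Ay; apply; apply: fAB.
Qed.

Lemma continuous_cont_on (X Y : topologicalType) (A : set X) (f : X -> Y) :
  continuous f -> cont_on A f.
Proof. by move=> cf x _; apply: cvg_within_filter; apply: cf. Qed.

Lemma cont_on_pair (X Y Z : topologicalType) (A : set X)
    (f : X -> Y) (g : X -> Z) :
  cont_on A f -> cont_on A g -> cont_on A (fun x => (f x, g x)).
Proof. by move=> cf cg x Ax; apply: cvg_pair; [apply: cf|apply: cg]. Qed.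

Lemma cont_on_fst (X Y : topologicalType) (A : set (X * Y)) : cont_on A fst.
Proof. by apply: continuous_cont_on => -[x y]; apply: cvg_fst. Qed.

Lemma cont_on_snd (X Y : topologicalType) (A : set (X * Y)) : cont_on A snd.
Proof. by apply: continuous_cont_on => -[x y]; apply: cvg_snd. Qed.

Lemma cont_on_cst (X Y : topologicalType) (A : set X) (y : Y) :
  cont_on A (fun=> y).
Proof. by move=> x _; apply: cvg_cst. Qed.

Lemma cont_on_id (X : topologicalType) (A : set X) : cont_on A id.
Proof. by apply: continuous_cont_on => x. Qed.

Variable R : realType.

(** Where [h x] differs from [c], a single formula is in force near [x]; where [h x = c], the two
    limits coincide and a neighbourhood of the common value is reached by both formulas. *)
Lemma cont_on_glue (X Y : topologicalType) (A : set X) (f g : X -> Y)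
    (h : X -> R) (c : R) :
  cont_on A f -> cont_on A g -> continuous h ->
  (forall x, A x -> h x = c -> f x = g x) ->
  cont_on A (fun x => if h x <= c then f x else g x).
Proof.
move=> cf cg ch fg x Ax U /= nU.
have [hx|hx|hx] := ltgtP (h x) c.
- have nf : nbhs x [set y | h y < c] by have := ch x _ (lt_nbhsl hx).
  rewrite (ltW hx) in nU.
  by apply: filterS2 nf (cf x Ax _ nU) => y /= yc Uy Ay; rewrite (ltW yc); apply: Uy.
- have nf : nbhs x [set y | c < h y] by have := ch x _ (lt_nbhsr hx).
  rewrite leNgt hx /= in nU; apply: filterS2 nf (cg x Ax _ nU) => y /= yc Uy Ay.
  by rewrite leNgt yc; apply: Uy.
rewrite hx lexx in nU; have nU' := nU; rewrite (fg x Ax hx) in nU'.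
have := cg x Ax _ nU'; have := cf x Ax _ nU.
apply: (@filterS2 _ (nbhs x)) => y /= Uf Ug Ay.
by case: ifP => _; [apply: Uf|apply: Ug].
Qed.

End ContinuousOn.

(** * Spaces with a group action and their equivariant homotopy calculus *)

Section GSpaces.
Local Open Scope classical_set_scope.
Local Open Scope ring_scope.

Variables (R : realType) (gT : finGroupType) (G : {group gT}).

(** The space is a subset of an ambient topological type, so that subspaces keep the same carrier
    and action. For realizations, [smap], [shomotopic] and [sequiv] unfold to [gmap], [ghomotopic]
    and [ghequiv]. *)
Record gspace := GSpace {
  gs_sort :> topologicalType;
  gs_set : set gs_sort;
  gs_act : gs_sort -> gT -> gs_sort
}.
Arguments gs_set : clear implicits.
Arguments gs_act {g} x a.
Implicit Types X Y Z : gspace.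

Definition smap X Y (f : X -> Y) : Prop :=
  [/\ {within gs_set X, continuous f},
      forall x, gs_set X x -> gs_set Y (f x)
    & forall x a, gs_set X x -> a \in G -> f (gs_act x a) = gs_act (f x) a].

Definition shomotopic X Y (f g : X -> Y) : Prop :=
  exists H : X * R -> Y,
  [/\ {within gs_set X `*` `[0, 1], continuous H},
      forall t, 0 <= t <= 1 -> smap (fun x => H (x, t)),
      forall x, gs_set X x -> H (x, 0) = f x
    & forall x, gs_set X x -> H (x, 1) = g x].

Definition sequiv X Y : Prop :=
  exists (f : X -> Y) (g : Y -> X),
  [/\ smap f, smap g, shomotopic (g \o f) id & shomotopic (f \o g) id].

Lemma smap_id X : smap (@id X).
Proof. by split=> //; apply/cont_onP/cont_on_id. Qed.

Lemma smap_comp X Y Z (f : X -> Y) (g : Y -> Z) :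
  smap f -> smap g -> smap (g \o f).
Proof.
move=> [/cont_onP cf mf ef] [/cont_onP cg mg eg]; split.
- by apply/cont_onP; apply: cont_on_comp cf mf cg.
- by move=> x Ax; apply/mg/mf.
- by move=> x a Ax Ga; rewrite /= ef ?eg //; apply: mf.
Qed.

Definition cyl X : set (X * R) := gs_set X `*` `[0, 1].
Arguments cyl : clear implicits.

(** Continuity of each stage comes for free from continuity on the cylinder, by composing with
    [x |-> (x, t)]. *)
Lemma shomotopic_intro X Y (f g : X -> Y) (H : X * R -> Y) :
  cont_on (cyl X) H ->
  (forall x t, gs_set X x -> 0 <= t <= 1 -> gs_set Y (H (x, t))) ->
  (forall x t a, gs_set X x -> 0 <= t <= 1 -> a \in G ->
     H (gs_act x a, t) = gs_act (H (x, t)) a) ->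
  (forall x, gs_set X x -> H (x, 0) = f x) ->
  (forall x, gs_set X x -> H (x, 1) = g x) ->
  shomotopic f g.
Proof.
move=> cH mH eH H0 H1; exists H; split=> //; first exact/cont_onP.
move=> t t01; split=> [|x Xx|x a Xx Ga]; [|exact: mH|exact: eH].
apply/cont_onP; apply: (cont_on_comp (f := fun x => (x, t))) cH.
  by apply: cont_on_pair; [apply: cont_on_id|apply: cont_on_cst].
by move=> x Xx; split=> //=; rewrite in_itv.
Qed.

Lemma shomotopic_elim X Y (f g : X -> Y) :
  shomotopic f g -> exists H : X * R -> Y,
  [/\ cont_on (cyl X) H,
      forall x t, gs_set X x -> 0 <= t <= 1 -> gs_set Y (H (x, t)),
      forall x t a, gs_set X x -> 0 <= t <= 1 -> a \in G ->
        H (gs_act x a, t) = gs_act (H (x, t)) a,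
      forall x, gs_set X x -> H (x, 0) = f x
    & forall x, gs_set X x -> H (x, 1) = g x].
Proof.
move=> [H [/cont_onP cH mH H0 H1]]; exists H; split=> //.
  by move=> x t Xx /mH[_ + _]; apply.
by move=> x t a Xx /mH[_ _ +] Ga; apply.
Qed.

Lemma shomotopic_eq X Y (f g : X -> Y) :
  smap f -> (forall x, gs_set X x -> f x = g x) -> shomotopic f g.
Proof.
move=> [/cont_onP cf mf ef] fg.
apply: (@shomotopic_intro _ _ _ _ (fun z => f z.1)) => //=.
- apply: (@cont_on_comp _ _ _ _ _ fst f (@cont_on_fst _ _ _) _ cf).
  by move=> [x t] [].
- by move=> x t Xx _; apply: mf.
- by move=> x t a Xx _; apply: ef.
Qed.

Lemma shomotopic_trans X Y (f g h : X -> Y) :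
  shomotopic f g -> shomotopic g h -> shomotopic f h.
Proof.
move=> /shomotopic_elim[F [cF mF eF F0 F1]] /shomotopic_elim[K [cK mK eK K0 K1]].
(* Truncating the rescaled times to [0, 1] makes both halves continuous on the whole cylinder, as
   [cont_on_glue] requires. *)
pose F' (z : X * R) := F (z.1, Num.min 1 (2 * z.2)).
pose K' (z : X * R) := K (z.1, Num.max 0 (2 * z.2 - 1)).
have cF' : cont_on (cyl X) F'.
  apply: (@cont_on_comp _ _ _ _ (cyl X)
    (fun z : X * R => (z.1, Num.min 1 (2 * z.2))) F _ _ cF).
    apply: cont_on_pair; first exact: cont_on_fst.
    apply: continuous_cont_on => z; apply: (@continuous_min R _ (fun=> 1)
      (fun z : X * R => 2 * z.2)).
      exact: cvg_cst.
    by apply: cvgM; [apply: cvg_cst|case: z => ? ?; apply: cvg_snd].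
  move=> [x t] [/= Xx]; rewrite in_itv /= => /andP[t0 t1]; split=> //=.
  by rewrite in_itv /= ge_min lexx /= le_min ler01 /= mulr_ge0.
have cK' : cont_on (cyl X) K'.
  apply: (@cont_on_comp _ _ _ _ (cyl X)
    (fun z : X * R => (z.1, Num.max 0 (2 * z.2 - 1))) K _ _ cK).
    apply: cont_on_pair; first exact: cont_on_fst.
    apply: continuous_cont_on => z; apply: (@continuous_max R _ (fun=> 0)
      (fun z : X * R => 2 * z.2 - 1)).
      exact: cvg_cst.
    apply: cvgB; last exact: cvg_cst.
    by apply: cvgM; [apply: cvg_cst|case: z => ? ?; apply: cvg_snd].
  move=> [x t] [/= Xx]; rewrite in_itv /= => /andP[t0 t1]; split=> //=.
  by rewrite in_itv /= le_max lexx /= ge_max ler01 /=; lra.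
have minE (t : R) : 0 <= t <= 1 -> t <= 2^-1 -> Num.min 1 (2 * t) = 2 * t.
  by move=> t01 th; apply/min_idPr; lra.
have maxE (t : R) : 2^-1 <= t -> Num.max 0 (2 * t - 1) = 2 * t - 1.
  by move=> th; apply/max_idPr; lra.
pose H (z : X * R) := if z.2 <= 2^-1 then F' z else K' z.
apply: (@shomotopic_intro _ _ _ _ H).
- apply: cont_on_glue => //; first by case=> ? ?; apply: cvg_snd.
  move=> [x t] [/= Xx _] ->; rewrite /F' /K' /=.
  rewrite minE ?maxE ?mulfV ?subrr ?F1 ?K0 ?pnatr_eq0 //; lra.
- move=> x t Xx t01; rewrite /H /F' /K' /=; case: ifPn => th.
    by rewrite minE //; apply: mF => //; lra.
  by rewrite maxE; [apply: mK => //|]; lra.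
- move=> x t a Xx t01 Ga; rewrite /H /F' /K' /=; case: ifPn => th.
    by rewrite minE //; apply: eF => //; lra.
  by rewrite maxE; [apply: eK => //|]; lra.
- move=> x Xx; rewrite /H /F' /K' /= invr_ge0 ler0n mulr0.
  by rewrite (min_idPr _) ?ler01 ?F0.
- move=> x Xx; rewrite /H /F' /K' /=.
  have -> : (1 <= 2^-1 :> R) = false by apply/negbTE; lra.
  by rewrite mulr1 (_ : 2 - 1 = 1 :> R); [rewrite (max_idPr _) ?ler01 ?K1|lra].
Qed.

Lemma shomotopic_compl X Y Z (f g : X -> Y) (k : Y -> Z) :
  smap k -> shomotopic f g -> shomotopic (k \o f) (k \o g).
Proof.
move=> [/cont_onP ck mk ek] /shomotopic_elim[H [cH mH eH H0 H1]].
apply: (@shomotopic_intro _ _ _ _ (fun z => k (H z))) => /=.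
- apply: (@cont_on_comp _ _ _ _ _ H k cH _ ck) => -[x t] [/= Xx].
  by rewrite in_itv /=; apply: mH.
- by move=> x t Xx t01; apply/mk/mH.
- by move=> x t a Xx t01 Ga; rewrite eH // ek //; apply: mH.
- by move=> x Xx; rewrite H0.
- by move=> x Xx; rewrite H1.
Qed.

Lemma shomotopic_compr X Y Z (f g : Y -> Z) (k : X -> Y) :
  smap k -> shomotopic f g -> shomotopic (f \o k) (g \o k).
Proof.
move=> [/cont_onP ck mk ek] /shomotopic_elim[H [cH mH eH H0 H1]].
apply: (@shomotopic_intro _ _ _ _ (fun z => H (k z.1, z.2))) => /=.
- apply: (@cont_on_comp _ _ _ _ _ (fun z => (k z.1, z.2)) H _ _ cH).
    apply: cont_on_pair; last exact: cont_on_snd.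
    apply: (@cont_on_comp _ _ _ _ _ fst k (@cont_on_fst _ _ _) _ ck).
    by move=> [x t] [].
  by move=> [x t] [/= /mk Xx].
- by move=> x t Xx t01; apply/mH/t01/mk.
- by move=> x t a Xx t01 Ga; rewrite ek // eH //; apply: mk.
- by move=> x Xx; rewrite H0 //; apply: mk.
- by move=> x Xx; rewrite H1 //; apply: mk.
Qed.

Lemma sequiv_homeo X Y (f : X -> Y) (g : Y -> X) :
  smap f -> smap g -> (forall x, gs_set X x -> g (f x) = x) ->
  (forall y, gs_set Y y -> f (g y) = y) -> sequiv X Y.
Proof.
move=> mf mg fK gK; exists f, g; split=> //.
  by apply: shomotopic_eq fK; apply: smap_comp.
by apply: shomotopic_eq gK; apply: smap_comp.
Qed.

Lemma sequiv_refl X : sequiv X X.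
Proof. by apply: (sequiv_homeo (f := id) (g := id)) => //; apply: smap_id. Qed.

Lemma sequiv_sym X Y : sequiv X Y -> sequiv Y X.
Proof. by move=> [f [g [mf mg gf fg]]]; exists g, f. Qed.

Lemma sequiv_trans X Y Z : sequiv X Y -> sequiv Y Z -> sequiv X Z.
Proof.
have aux (U V W : gspace) (f : U -> V) g (f' : V -> W) g' :
    smap f -> smap g -> shomotopic (g \o f) id -> shomotopic (g' \o f') id ->
    shomotopic ((g \o g') \o (f' \o f)) id.
  (* The inner composite [g' \o f'] is deformed to the identity first, then the remaining
     [g \o f]. *)
  move=> mf mg gf gf'; apply: shomotopic_trans gf.
  exact: shomotopic_compl mg (shomotopic_compr mf gf').
move=> [f [g [mf mg gf fg]]] [f' [g' [mf' mg' gf' fg']]].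
exists (f' \o f), (g \o g'); split; try exact: smap_comp; exact: aux.
Qed.

Definition prods X Y : gspace :=
  @GSpace (X * Y)%type (gs_set X `*` gs_set Y)
    (fun z a => (gs_act z.1 a, gs_act z.2 a)).

Lemma smap_fst X Y : smap (fst : prods X Y -> X).
Proof. by split=> [|x []|] //; apply/cont_onP/cont_on_fst. Qed.

Lemma smap_snd X Y : smap (snd : prods X Y -> Y).
Proof. by split=> [|x []|] //; apply/cont_onP/cont_on_snd. Qed.

Lemma smap_pair X Y Z (f : X -> Y) (g : X -> Z) :
  smap f -> smap g -> smap (fun x => (f x, g x) : prods Y Z).
Proof.
move=> [/cont_onP cf mf ef] [/cont_onP cg mg eg]; split.
- by apply/cont_onP; apply: cont_on_pair.
- by move=> x Xx; split; [apply: mf|apply: mg].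
- by move=> x a Xx Ga; rewrite ef // eg.
Qed.

Lemma shomotopic_pair X Y Z (f f' : X -> Y) (g g' : X -> Z) :
  shomotopic f f' -> shomotopic g g' ->
  @shomotopic X (prods Y Z) (fun x => (f x, g x)) (fun x => (f' x, g' x)).
Proof.
move=> /shomotopic_elim[F [cF mF eF F0 F1]] /shomotopic_elim[K [cK mK eK K0 K1]].
apply: (@shomotopic_intro _ (prods Y Z) _ _ (fun z => (F z, K z))) => /=.
- exact: cont_on_pair.
- by move=> x t Xx t01; split; [apply: mF|apply: mK].
- by move=> x t a Xx t01 Ga; rewrite eF // eK.
- by move=> x Xx; rewrite F0 // K0.
- by move=> x Xx; rewrite F1 // K1.
Qed.

Lemma sequiv_prods X X' Y Y' :
  sequiv X X' -> sequiv Y Y' -> sequiv (prods X Y) (prods X' Y').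
Proof.
have aux (U U' V V' : gspace) (f : U -> U') (g : U' -> U) (f' : V -> V')
    (g' : V' -> V) :
    shomotopic (g \o f) id -> shomotopic (g' \o f') id ->
  @shomotopic (prods U V) (prods U V)
   ((fun z => (g z.1, g' z.2)) \o (fun z => (f z.1, f' z.2))) id.
  move=> h h'; rewrite (_ : id = (fun z : prods U V => (z.1, z.2))); last first.
    by apply/funext => -[].
  apply: (@shomotopic_pair (prods U V) U V (fun z => g (f z.1)) _
    (fun z => g' (f' z.2))).
    exact: shomotopic_compr (@smap_fst U V) h.
  exact: shomotopic_compr (@smap_snd U V) h'.
move=> [f [g [mf mg gf fg]]] [f' [g' [mf' mg' gf' fg']]].
exists (fun z => (f z.1, f' z.2)), (fun z => (g z.1, g' z.2)).
split; try exact: aux.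
  apply: (@smap_pair (prods X Y) X' Y').
    exact: smap_comp (@smap_fst X Y) mf.
  exact: smap_comp (@smap_snd X Y) mf'.
apply: (@smap_pair (prods X' Y') X Y).
  exact: smap_comp (@smap_fst X' Y') mg.
exact: smap_comp (@smap_snd X' Y') mg'.
Qed.

Lemma sequiv_prodsA X Y Z :
  sequiv (prods X (prods Y Z)) (prods (prods X Y) Z).
Proof.
apply: (@sequiv_homeo (prods X (prods Y Z)) (prods (prods X Y) Z)
  (fun z => ((z.1, z.2.1), z.2.2)) (fun z => (z.1.1, (z.1.2, z.2)))).
- apply: (@smap_pair (prods X (prods Y Z)) (prods X Y) Z).
    apply: smap_pair; first exact: smap_fst.
    exact: smap_comp (@smap_snd X (prods Y Z)) (@smap_fst Y Z).
  exact: smap_comp (@smap_snd X (prods Y Z)) (@smap_snd Y Z).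
- apply: (@smap_pair (prods (prods X Y) Z) X (prods Y Z)).
    exact: smap_comp (@smap_fst (prods X Y) Z) (@smap_fst X Y).
  apply: smap_pair; last exact: smap_snd.
  exact: smap_comp (@smap_fst (prods X Y) Z) (@smap_snd X Y).
- by move=> [? [? ?]].
- by move=> [[? ?] ?].
Qed.

Lemma smap_cst X Y (y : Y) :
  gs_set Y y -> (forall a, a \in G -> gs_act y a = y) -> smap (fun _ : X => y).
Proof.
move=> Yy ya; split=> // [|x a _ /ya-> //].
exact/cont_onP/cont_on_cst.
Qed.

Lemma sequiv_prods1 X Y (y : Y) :
  gs_set Y = [set y] -> (forall a, a \in G -> gs_act y a = y) ->
  sequiv (prods X Y) X.
Proof.
move=> eY ya; have Yy : gs_set Y y by rewrite eY.
apply: (@sequiv_homeo (prods X Y) X fst (fun x => (x, y))) => //.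
- exact: smap_fst.
- by apply: smap_pair; [apply: smap_id|apply: smap_cst].
- by move=> [x y'] [/= _]; rewrite eY => ->.
Qed.

Lemma sequiv_prodsC X Y : sequiv (prods X Y) (prods Y X).
Proof.
apply: (@sequiv_homeo (prods X Y) (prods Y X)
  (fun z => (z.2, z.1)) (fun z => (z.2, z.1))); try by case.
  by apply: (@smap_pair (prods X Y)); [apply: smap_snd|apply: smap_fst].
by apply: (@smap_pair (prods Y X)); [apply: smap_snd|apply: smap_fst].
Qed.

(** Asking for a fixing element of order [p], rather than for a stabilizer of order divisible by
    [p], makes the condition pass through equivariant maps at once. *)
Definition psing (p : nat) X : gspace :=
  @GSpace X [set x | gs_set X x /\
    exists a, [/\ a \in G, #[a]%g = p & gs_act x a = x]] (@gs_act X).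

(** By equivariance, an element that fixes [x] also fixes [f x]. *)
Lemma smap_psing p X Y (f : X -> Y) :
  smap f -> @smap (psing p X) (psing p Y) f.
Proof.
move=> [/cont_onP cf mf ef]; split.
- apply/cont_onP; apply: (cont_on_comp (cont_on_id (A := _)) _ cf).
  by move=> x [].
- move=> x [Xx [a [Ga pa xa]]]; split; first exact: mf.
  by exists a; split=> //; rewrite -ef // xa.
- by move=> x a [Xx _]; apply: ef.
Qed.

(** Every stage of an equivariant homotopy is an equivariant map, so homotopies restrict to the
    singular parts. *)
Lemma sequiv_psing p X Y : sequiv X Y -> sequiv (psing p X) (psing p Y).
Proof.
have aux (U V : gspace) (f g : U -> V) :
    shomotopic f g -> @shomotopic (psing p U) (psing p V) f g.
  move=> [H [/cont_onP cH mH H0 H1]]; exists H; split.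
  - apply/cont_onP; apply: (cont_on_comp (cont_on_id (A := _)) _ cH).
    by move=> [x t] [] [].
  - by move=> t t01; apply/smap_psing/mH.
  - by move=> x [Xx _]; apply: H0.
  - by move=> x [Xx _]; apply: H1.
move=> [f [g [mf mg gf fg]]]; exists f, g.
by split; try exact: smap_psing; exact: aux.
Qed.

(** Meant for complexes that differ as records but share vertex type and action up to conversion:
    only their sets of points have to be compared. *)
Lemma sequiv_eqset (T : topologicalType) (A B : set T) (act : T -> gT -> T) :
  A = B -> sequiv (GSpace A act) (GSpace B act).
Proof. by move=> ->; apply: sequiv_refl. Qed.

(** The two sets are equal: an element fixing a pair fixes its first component, which is therefore
    already singular. *)
Lemma sequiv_psing_prodsl p X Y :
  sequiv (psing p (prods (psing p X) Y)) (psing p (prods X Y)).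
Proof.
apply: sequiv_eqset; apply/seteqP; split=> -[x y] /=.
  by move=> [[[Xx _] Yy] h].
move=> [[Xx Yy] [a [Ga pa exy]]]; have [ex ey] := exy.
by split; [split=> //; split=> //|]; exists a; split; rewrite ?ex ?ey.
Qed.

Lemma sequiv_psing_prodsr p X Y :
  sequiv (psing p (prods X (psing p Y))) (psing p (prods X Y)).
Proof.
apply: sequiv_eqset; apply/seteqP; split=> -[x y] /=.
  by move=> [[Xx [Yy _]] h].
move=> [[Xx Yy] [a [Ga pa exy]]]; have [ex ey] := exy.
by split; [split=> //; split=> //|]; exists a; split; rewrite ?ex ?ey.
Qed.

End GSpaces.
Arguments gs_set {gT} g x.
Arguments gs_act {gT g} x a.

(** * Relative continuity of arithmetic, finite sums, products, maxima and coordinates *)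

Section ContinuousReal.
Local Open Scope classical_set_scope.
Local Open Scope ring_scope.
Variables (R : realType) (X : topologicalType) (A : set X).
Implicit Types f g : X -> R.

Lemma cont_onD f g :
  cont_on A f -> cont_on A g -> cont_on A (fun x => f x + g x).
Proof. by move=> cf cg x Ax; apply: cvgD; [apply: cf|apply: cg]. Qed.

Lemma cont_onB f g :
  cont_on A f -> cont_on A g -> cont_on A (fun x => f x - g x).
Proof. by move=> cf cg x Ax; apply: cvgB; [apply: cf|apply: cg]. Qed.

Lemma cont_onM f g :
  cont_on A f -> cont_on A g -> cont_on A (fun x => f x * g x).
Proof. by move=> cf cg x Ax; apply: cvgM; [apply: cf|apply: cg]. Qed.

Lemma cont_on_div f g :
  cont_on A f -> cont_on A g -> (forall x, A x -> g x != 0) ->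
  cont_on A (fun x => f x / g x).
Proof.
move=> cf cg g0 x Ax; apply: cvgM; first exact: cf.
by apply: cvgV; [apply: g0|apply: cg].
Qed.

Lemma max_cont : continuous (fun z : R * R => Num.max z.1 z.2).
Proof.
move=> z; apply: (@continuous_max R _ fst snd); case: z => ? ?.
  exact: cvg_fst.
exact: cvg_snd.
Qed.

Lemma cont_on_max f g :
  cont_on A f -> cont_on A g -> cont_on A (fun x => Num.max (f x) (g x)).
Proof.
move=> cf cg x Ax.
apply: (@continuous2_cvg X R R R (within A (nbhs x)) _ f g Num.max (f x) (g x)).
- exact: (@max_cont (f x, g x)).
- exact: cf.
- exact: cg.
Qed.

Lemma cont_on_sum (I : finType) (P : pred I) (F : I -> X -> R) :
  (forall i, P i -> cont_on A (F i)) ->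
  cont_on A (fun x => \sum_(i | P i) F i x).
Proof.
move=> cF x Ax; apply: cvg_big => [|i /cF]; first exact: add_continuous.
exact.
Qed.

Lemma cont_on_prod (I : finType) (P : pred I) (F : I -> X -> R) :
  (forall i, P i -> cont_on A (F i)) ->
  cont_on A (fun x => \prod_(i | P i) F i x).
Proof.
move=> cF x Ax; apply: cvg_big => [|i /cF]; first exact: mul_continuous.
exact.
Qed.

Lemma cont_on_bigmax (I : finType) (P : pred I) (F : I -> X -> R) :
  (forall i, P i -> cont_on A (F i)) ->
  cont_on A (fun x => \big[Num.max/0]_(i | P i) F i x).
Proof.
move=> cF x Ax; apply: cvg_big => [|i /cF]; first exact: max_cont.
exact.
Qed.

(* The discrete topology is only there to state pointwise_cvgP, whose
   functions have a topological domain. *)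
Lemma cont_on_ptws (V : choiceType) (f : X -> {ptws V -> R}) :
  cont_on A f <-> forall v, cont_on A (fun x => f x v).
Proof.
have P x := @pointwise_cvgP (discrete_topology V) R
  (f @ within A (nbhs x)) (f x) _.
split=> [cf v x Ax|cf x Ax]; last by apply/P => v; apply: cf.
by have /P := cf x Ax; apply.
Qed.

Lemma cont_on_coord (V : choiceType) (B : set {ptws V -> R}) v :
  cont_on B (fun x => x v).
Proof. by apply: continuous_cont_on; apply: proj_continuous. Qed.

End ContinuousReal.

(** * Realizations as G-spaces: normalization, straight-line homotopies, spreading of weights *)

Section Realizations.
Local Open Scope ring_scope.
Variables (R : realType) (gT : finGroupType) (G : {group gT}).
Implicit Types D E : gcomplex G.

Definition rspace D : gspace gT :=
  GSpace (realization R D) (@realact R gT G D).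

Definition supp (T : finType) (h : T -> R) : {set T} := [set v | h v != 0].

Lemma in_setact (aT : finGroupType) (T : finType) (H : {group aT})
    (to : action H T) (S : {set T}) a v :
  a \in H -> (v \in (to^*)%act S a) = (to v a^-1%g \in S).
Proof.
move=> Ha; apply/imsetP/idP => [[w Sw ->]|Sv]; first by rewrite actKin.
by exists (to v a^-1%g); rewrite ?actKVin.
Qed.

Lemma sum_realact D (h : gc_vert D -> R) a :
  \sum_v h (gc_act D v a) = \sum_v h v.
Proof. by rewrite [RHS](reindex_inj (act_inj (gc_act D) a)). Qed.

Definition normalize (T : finType) (h : T -> R) : T -> R :=
  fun v => h v / \sum_w h w.

Lemma supp_normalize (T : finType) (h : T -> R) :
  supp (normalize h) \subset supp h.
Proof.
apply/subsetP => v; rewrite !inE; apply: contraNN => /eqP h0.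
by rewrite /normalize h0 mul0r.
Qed.

Lemma sum_supp_gt0 (T : finType) (h : T -> R) :
  (forall v, 0 <= h v) -> supp h != set0 -> 0 < \sum_v h v.
Proof.
move=> h0 /set0Pn[v]; rewrite inE => hv.
rewrite (bigD1 v) //= ltr_pwDl ?sumr_ge0 // lt_neqAle eq_sym hv; exact: h0.
Qed.

(** Total weight 1 forces a non-empty support, and non-empty subsets of simplices are simplices; so
    an upper bound on the support suffices. *)
Lemma realizationP D (h : gc_vert D -> R) (s : {set gc_vert D}) :
  (forall v, 0 <= h v) -> \sum_v h v = 1 -> supp h \subset s ->
  s \in gc_simp D -> realization R D h.
Proof.
move=> h0 h1 sh Ds; split=> //; apply: gc_simp_sub Ds _ sh.
apply/negP => /eqP e; have /eqP := h1; rewrite big1 ?(eq_sym 0) ?oner_eq0 // => v _.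
apply/eqP; have : v \notin supp h by rewrite [supp h]e inE.
by rewrite inE negbK.
Qed.

(** Simplices are non-empty, so the total weight is positive and the division continuous; the total
    is invariant under the action, so normalizing is equivariant. *)
Lemma smap_normalize (X : gspace gT) D (h : X -> gpoints R D) :
  (forall v, cont_on (gs_set X) (fun x => h x v)) ->
  (forall x v, gs_set X x -> 0 <= h x v) ->
  (forall x, gs_set X x -> supp (h x) \in gc_simp D) ->
  (forall x a v, gs_set X x -> a \in G ->
     h (gs_act x a) v = h x (gc_act D v a^-1%g)) ->
  @smap gT G X (rspace D) (fun x => normalize (h x)).
Proof.
move=> ch h0 hs ha.
have S0 x : gs_set X x -> 0 < \sum_v h x v.
  by move=> Xx; apply: sum_supp_gt0 => [v|]; [apply: h0|apply/gc_simp_neq0/hs].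
split.
- apply/cont_onP/cont_on_ptws => v; apply: cont_on_div => //.
    by apply: cont_on_sum => w _; apply: ch.
  by move=> x /S0; apply: lt0r_neq0.
- move=> x Xx; apply: (realizationP _ _ (supp_normalize (h x)) (hs x Xx)).
    by move=> v; rewrite divr_ge0 ?(ltW (S0 _ _)) // h0.
  by rewrite -mulr_suml mulfV // lt0r_neq0 // S0.
- move=> x a Xx Ga; apply/funext => v; rewrite /= /realact /normalize ha //.
  by congr (_ / _); under eq_bigr do rewrite ha //; apply: sum_realact.
Qed.

(** A convex combination is supported in the union of the two supports, so each segment stays inside
    one closed simplex. *)
Lemma shomotopic_line (X : gspace gT) D (f g : X -> gpoints R D) :
  @smap gT G X (rspace D) f -> @smap gT G X (rspace D) g ->
  (forall x, gs_set X x -> supp (f x) :|: supp (g x) \in gc_simp D) ->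
  @shomotopic R gT G X (rspace D) f g.
Proof.
move=> [/cont_onP/cont_on_ptws cf mf ef] [/cont_onP/cont_on_ptws cg mg eg] fg.
pose H (z : X * R) : gpoints R D :=
  fun v => (1 - z.2) * f z.1 v + z.2 * g z.1 v.
apply: (@shomotopic_intro _ _ _ _ (rspace D) _ _ H).
- apply/cont_on_ptws => v; apply: cont_onD; apply: cont_onM.
  + by apply: cont_onB; [apply: cont_on_cst|apply: cont_on_snd].
  + apply: (@cont_on_comp _ _ _ _ _ fst (fun x => f x v) _ _ (cf v)).
      exact: cont_on_fst.
    by move=> [x t] [].
  + exact: cont_on_snd.
  + apply: (@cont_on_comp _ _ _ _ _ fst (fun x => g x v) _ _ (cg v)).
      exact: cont_on_fst.
    by move=> [x t] [].
- move=> x t Xx /andP[t0 t1]; have [f0 f1 _] := mf x Xx; have [g0 g1 _] := mg x Xx.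
  apply: realizationP (fg x Xx).
  + move=> v; rewrite /H /= addr_ge0 ?mulr_ge0 ?subr_ge0 //.
  + rewrite /H /= big_split /= -!mulr_sumr f1 g1; lra.
  + apply/subsetP => v; rewrite !inE -negb_and; apply: contraNN.
    by move=> /andP[/eqP e1 /eqP e2]; rewrite /H /= e1 e2; apply/eqP; lra.
- by move=> x t a Xx t01 Ga; rewrite /H /= ef // eg.
- by move=> x Xx; apply/funext => v; rewrite /H /=; lra.
- by move=> x Xx; apply/funext => v; rewrite /H /=; lra.
Qed.

Section Carrier.
Variables (D E : gcomplex G) (k : gc_vert E -> {set gc_vert D}).
Hypothesis k_neq0 : forall C u, C \in gc_simp E -> u \in C -> k u != set0.
Hypothesis k_simp : forall C, C \in gc_simp E ->
  exists2 s, s \in gc_simp D & forall u, u \in C -> k u \subset s.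
Hypothesis k_act : forall u a, a \in G ->
  k (gc_act E u a) = ((gc_act D)^*)%act (k u) a.

(** Each vertex of [k u] receives the full weight of [u] and not a share of it, so the result is a
    combination of indicator functions of the sets [k u]. *)
Definition spread (x : gpoints R E) : gpoints R D :=
  fun v => \sum_(u | v \in k u) x u.

(** Non-negative weights cannot cancel. *)
Lemma supp_spread x :
  (forall u, 0 <= x u) -> supp (spread x) = \bigcup_(u in supp x) k u.
Proof.
move=> x0; apply/setP => v; rewrite inE psumr_neq0 //.
apply/hasP/bigcupP => [[u _ /andP[kv xu]]|[u xu kv]].
  by exists u; rewrite // inE lt0r_neq0.
rewrite inE in xu.
by exists u; rewrite ?mem_index_enum // kv lt_neqAle eq_sym xu x0.
Qed.

Lemma smap_spread : @smap gT G (rspace E) (rspace D) (fun x => normalize (spread x)).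
Proof.
apply: (@smap_normalize (rspace E)).
- by move=> v; apply: cont_on_sum => u _; apply: cont_on_coord.
- by move=> x v [x0 _ _]; apply: sumr_ge0.
- move=> x [x0 _ xs]; rewrite supp_spread //.
  have [s Ds ks] := k_simp xs; apply: gc_simp_sub Ds _ _; last first.
    by apply/bigcupsP => u xu; apply: ks.
  have /gc_simp_neq0/set0Pn[u xu] := xs; have /set0Pn[v kv] := k_neq0 xs xu.
  by apply/set0Pn; exists v; apply/bigcupP; exists u.
- move=> x a v _ Ga; rewrite /spread /= (reindex_inj (act_inj (gc_act E) a)) /=.
  apply: eq_big => [u|u _]; first by rewrite k_act // in_setact.
  by rewrite /realact actKin.
Qed.

End Carrier.

End Realizations.

(** * Detecting superlevel sets of a non-negative function continuously *)

Section Level.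
Local Open Scope ring_scope.
Variables (R : realType) (T : finType).
Implicit Types (c : T -> R) (U : {set T}).

(* A continuous function of c, positive exactly when U is a superlevel set
   {c > r} with r >= 0. *)
Definition level c U : R :=
  \prod_(i | i \in U) c i *
  \prod_(i | i \in U) \prod_(j | j \notin U) Num.max 0 (c i - c j).

Lemma level_ge0 c U : (forall i, 0 <= c i) -> 0 <= level c U.
Proof.
move=> c0; apply: mulr_ge0; apply: prodr_ge0 => // i _.
by apply: prodr_ge0 => j _; rewrite le_max lexx.
Qed.

Lemma level_neq0P c U : (forall i, 0 <= c i) ->
  reflect ((forall i, i \in U -> 0 < c i) /\
           (forall i j, i \in U -> j \notin U -> c j < c i))
          (level c U != 0).
Proof.
move=> c0; rewrite mulf_eq0 negb_or.
apply: (iffP andP) => [[/prodf_neq0 h1 /prodf_neq0 h2]|[h1 h2]].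
  split=> [i Ui|i j Ui nUj]; first by rewrite lt_neqAle eq_sym h1 ?c0.
  have /prodf_neq0/(_ j nUj) := h2 i Ui; apply: contraNlt => le.
  by apply/eqP/max_idPl; rewrite subr_le0.
split; apply/prodf_neq0 => i Ui; first exact/lt0r_neq0/h1.
apply/prodf_neq0 => j nUj; have ji := h2 i j Ui nUj.
by rewrite lt0r_neq0 // lt_max subr_gt0 ji orbT.
Qed.

(** An [i] in [U] only and a [j] in [U'] only would give both [c j < c i] and [c i < c j]. *)
Lemma level_chain c U U' : (forall i, 0 <= c i) ->
  level c U != 0 -> level c U' != 0 -> U \subset U' \/ U' \subset U.
Proof.
move=> c0 /(level_neq0P _ c0)[_ hU] /(level_neq0P _ c0)[_ hU'].
have [|/subsetPn[i Ui nUi]] := boolP (U \subset U'); first by left.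
right; apply/subsetP => j U'j; apply/negPn/negP => nUj.
by have := lt_trans (hU i j Ui nUj) (hU' j i U'j nUi); rewrite ltxx.
Qed.

(** Provides a set of non-zero level, which later ensures that not all weights of a pair of points
    vanish. *)
Lemma level_top c : (forall i, 0 <= c i <= 1) -> level c [set i | c i == 1] != 0.
Proof.
move=> c01; apply/level_neq0P => [i|]; first by case/andP: (c01 i).
split=> [i|i j]; rewrite !inE => /eqP-> // nj.
by rewrite lt_neqAle nj; case/andP: (c01 j).
Qed.

Lemma level_reindex c (f : T -> T) U (V : {set T}) : injective f ->
  (forall i, (i \in U) = (f i \in V)) -> level (fun i => c (f i)) U = level c V.
Proof.
move=> finj fUV; rewrite /level; congr (_ * _).
  by rewrite [RHS](reindex_inj finj); apply: eq_bigl.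
rewrite [RHS](reindex_inj finj); apply: eq_big => // i _.
by rewrite [RHS](reindex_inj finj); apply: eq_bigl => j; rewrite fUV.
Qed.

(* The superlevel sets of a positive combination of the indicator functions of
   a chain of sets are members of that chain. *)
Lemma level_combination (I : finType) (J : I -> {set T}) (x : I -> R) U :
  (forall u, 0 <= x u) ->
  {in supp x &, forall u u', J u \subset J u' \/ J u' \subset J u} ->
  U != set0 -> level (fun i => \sum_(u | i \in J u) x u) U != 0 ->
  exists2 u, u \in supp x & J u = U.
Proof.
move=> x0 chJ /set0Pn[i1 Ui1]; set c := fun i => _.
have c0 i : 0 <= c i by apply: sumr_ge0.
move=> /(level_neq0P _ c0)[cpos clt].
(* The member sought is the smallest [J m] with [x m] non-zero that contains a point [i0] of [U]
   where [c] is least. *)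
have [i0 Ui0 i0min] : exists2 i0, i0 \in U & forall i, i \in U -> c i0 <= c i.
  by case: (Order.TotalTheory.arg_minP c Ui1) => i0 Ui0 h; exists i0.
have [u0 xu0 Ju0] : exists2 u, u \in supp x & i0 \in J u.
  have := lt0r_neq0 (cpos _ Ui0); rewrite psumr_neq0 //.
  by move=> /hasP[u _ /andP[iu xu]]; exists u; rewrite // inE lt0r_neq0.
have [m /andP[xm Jm] mmin] : exists2 m, (m \in supp x) && (i0 \in J m) &
    forall u, u \in supp x -> i0 \in J u -> J m \subset J u.
  have u0P : (u0 \in supp x) && (i0 \in J u0) by rewrite xu0.
  case: (@arg_minnP I u0 (fun u => (u \in supp x) && (i0 \in J u))
    (fun u => #|J u|) u0P) => m mP h; exists m => // u xu Ju.
  have /andP[xm _] := mP; have := h u; rewrite xu Ju => /(_ isT) le.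
  by case: (chJ u m xu xm) => // sub; have/eqP-> : J u == J m by rewrite eqEcard sub.
have x_mkcond i : c i = \sum_u (if i \in J u then x u else 0) by apply: big_mkcond.
(* A point of [J m] lies in every weighted set containing [i0], so its value is at least [c i0];
   points outside [U] have a smaller value. *)
exists m => //; apply/eqP; rewrite eqEsubset; apply/andP; split.
  apply/subsetP => i Ji; apply/negPn/negP => nUi.
  have := clt _ _ Ui0 nUi; apply/negP; rewrite -leNgt !x_mkcond.
  apply: ler_sum => u _; case: ifP => i0u; last by case: ifP.
  have [xu|] := boolP (u \in supp x).
    by rewrite (subsetP (mmin u xu i0u) i Ji).
  by rewrite inE negbK => /eqP->; case: ifP.
(* If [i] in [U] avoids [J m], each weighted set containing [i] contains [J m], hence [i0]; as [m]
   itself adds to [c i0] but not to [c i], this gives [c i < c i0], against the choice of [i0]. *)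
apply/subsetP => i Ui; apply/negPn/negP => nJi.
have := i0min i Ui; apply/negP; rewrite -ltNge !x_mkcond.
rewrite (bigD1 m) //= (bigD1 m (F := fun u => if i0 \in J u then _ else _)) //=.
rewrite (negbTE nJi) Jm add0r ltr_pwDl //.
  by move: xm; rewrite inE lt_neqAle eq_sym x0 andbT.
apply: ler_sum => u _; case: ifP => iu; last by case: ifP.
have [xu|] := boolP (u \in supp x); last by rewrite inE negbK => /eqP->; case: ifP.
case: (chJ u m xu xm) => sub; first by rewrite (subsetP sub _ iu) in nJi.
by rewrite (subsetP sub _ Jm).
Qed.

Lemma cont_on_level (X : topologicalType) (A : set X) (c : X -> T -> R) U :
  (forall i, cont_on A (fun x => c x i)) -> cont_on A (fun x => level (c x) U).
Proof.
move=> cc; apply: cont_onM; first by apply: cont_on_prod.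
apply: cont_on_prod => i _; apply: cont_on_prod => j _.
by apply: cont_on_max; [apply: cont_on_cst|apply: cont_onB].
Qed.

End Level.

(** * The maximum of a non-negative function on a finite set *)

Section MaxNorm.
Local Open Scope ring_scope.
Variables (R : realType).

Definition maxnorm (T : finType) (a : T -> R) : R := \big[Num.max/0]_v a v.

Lemma le_maxnorm (T : finType) (a : T -> R) v : a v <= maxnorm a.
Proof. exact: le_bigmax. Qed.

(** The condition [0 <= a v] is due to the default value 0 of the big maximum. *)
Lemma maxnormE (T : finType) (a : T -> R) v :
  0 <= a v -> (forall w, a w <= a v) -> maxnorm a = a v.
Proof.
by move=> a0 av; apply/le_anti; rewrite le_maxnorm bigmax_le.
Qed.

Lemma maxnorm_attained (T : finType) (a : T -> R) :
  (forall v, 0 <= a v) -> supp a != set0 -> exists2 v, 0 < a v & maxnorm a = a v.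
Proof.
move=> a0 /set0Pn[v0]; rewrite inE => v00.
case: (Order.TotalTheory.arg_maxP a (erefl : xpredT v0)) => v _ vmax.
exists v; last by apply: maxnormE => // w; apply: vmax.
apply: lt_le_trans (vmax v0 isT); by rewrite lt_neqAle eq_sym v00 a0.
Qed.

End MaxNorm.

(** * The realization of a product of complexes against the product of the realizations *)

Section ProductRealization.
Local Open Scope ring_scope.
Variables (R : realType) (gT : finGroupType) (G : {group gT}).
Variables (D1 D2 : gcomplex G).

Let V1 := gc_vert D1.
Let V2 := gc_vert D2.
Let E := prodc D1 D2.
Let Q := prods (rspace R D1) (rspace R D2).

(** Comparable pairs of equal total cardinality are equal, so a member of the chain maximizing it is
    greatest. Its components are simplices containing all other components, as spreading needs. *)
Lemma prodc_top C : C \in gc_simp E ->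
  exists2 t : gc_vert E, t \in C & forall u, u \in C -> prod_le u t.
Proof.
rewrite inE => /and3P[/set0Pn[u0 Cu0] _ chC].
case: (@arg_maxnP _ u0 [in C] (fun u => #|u.1| + #|u.2|)%N Cu0) => t Ct tmax.
exists t => // u Cu; have le : (#|u.1| + #|u.2| <= #|t.1| + #|t.2|)%N := tmax u Cu.
case/orP: (forall_inP (forall_inP chC u Cu) t Ct) => // tu.
suff -> : t = u by apply/andP.
apply: (prod_le_card tu); apply/eqP; rewrite eqn_leq le andbT.
by case/andP: tu => s1 s2; rewrite leq_add ?subset_leq_card.
Qed.

Lemma prodc_mem C u : C \in gc_simp E -> u \in C ->
  u.1 \in gc_simp D1 /\ u.2 \in gc_simp D2.
Proof.
rewrite inE => /and3P[_ /subsetP sC _] /sC; rewrite inE => /andP[] //.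
Qed.

Definition prodc_fst (x : gpoints R E) : gpoints R D1 :=
  normalize (spread (fun u : gc_vert E => u.1) x).
Definition prodc_snd (x : gpoints R E) : gpoints R D2 :=
  normalize (spread (fun u : gc_vert E => u.2) x).

Lemma smap_prodc_fst : @smap gT G (rspace R E) (rspace R D1) prodc_fst.
Proof.
apply: smap_spread => [C u CE Cu|C CE|//].
  by case: (prodc_mem CE Cu) => /gc_simp_neq0.
have [t Ct tmax] := prodc_top CE; exists t.1; first by case: (prodc_mem CE Ct).
by move=> u /tmax/andP[].
Qed.

Lemma smap_prodc_snd : @smap gT G (rspace R E) (rspace R D2) prodc_snd.
Proof.
apply: smap_spread => [C u CE Cu|C CE|//].
  by case: (prodc_mem CE Cu) => _ /gc_simp_neq0.
have [t Ct tmax] := prodc_top CE; exists t.2; first by case: (prodc_mem CE Ct).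
by move=> u /tmax/andP[].
Qed.

(** Both points are scaled to maximum 1 and placed on the disjoint union of the vertex sets, so that
    a pair of superlevel sets at a common height is a superlevel set of one function. *)
Definition joint (z : Q) (i : V1 + V2) : R :=
  match i with
  | inl v => z.1 v / maxnorm z.1
  | inr w => z.2 w / maxnorm z.2
  end.

(** Turns the order of the product poset into inclusion of subsets of the disjoint union. *)
Definition jset (u : gc_vert E) : {set V1 + V2} :=
  [set i | match i with inl v => v \in u.1 | inr w => w \in u.2 end].

Lemma jset_sub u u' : (jset u \subset jset u') = prod_le u u'.
Proof.
apply/subsetP/andP => [s|[/subsetP s1 /subsetP s2] [v|w]]; rewrite ?inE; last 2 first.
- exact: s1.
- exact: s2.
split; apply/subsetP => v uv.
  by have := s (inl v); rewrite !inE => /(_ uv).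
by have := s (inr v); rewrite !inE => /(_ uv).
Qed.

Lemma jset_inj : injective jset.
Proof.
move=> u u' e; have := jset_sub u u'; have := jset_sub u' u.
rewrite e subxx => /esym/andP[a1 a2] /esym/andP[b1 b2].
by case: u u' a1 a2 b1 b2 {e} => [s t] [s' t'] /= a1 a2 b1 b2;
  congr (_, _); apply/eqP; rewrite eqEsubset ?a1 ?a2 ?b1 ?b2.
Qed.

(** Superlevel sets may miss one of the two vertex sets, and the empty set has level 1 as an empty
    product; the test discards such pairs, whose components are not both simplices. *)
Definition weight (z : Q) (u : gc_vert E) : R :=
  if (u.1 != set0) && (u.2 != set0) then level (joint z) (jset u) else 0.

Lemma maxnorm_gt0 (D : gcomplex G) (x : gpoints R D) :
  realization R D x -> 0 < @maxnorm R (gc_vert D) x.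
Proof.
move=> [x0 _ /gc_simp_neq0 xs].
by have [v v0 ->] := maxnorm_attained x0 xs.
Qed.

Lemma joint01 z i : gs_set Q z -> 0 <= joint z i <= 1.
Proof.
move=> [z1 z2]; case: i => [v|w] /=.
  rewrite divr_ge0 ?ler_pdivrMr ?mul1r ?le_maxnorm ?maxnorm_gt0 //.
  - by case: z1.
  - by rewrite ltW // maxnorm_gt0.
rewrite divr_ge0 ?ler_pdivrMr ?mul1r ?le_maxnorm ?maxnorm_gt0 //.
- by case: z2.
- by rewrite ltW // maxnorm_gt0.
Qed.

Lemma joint_ge0 z i : gs_set Q z -> 0 <= joint z i.
Proof. by move=> Qz; case/andP: (joint01 i Qz). Qed.

Lemma supp_weightP z u : gs_set Q z -> u \in supp (weight z) ->
  [/\ u.1 != set0, u.2 != set0, u.1 \subset supp z.1, u.2 \subset supp z.2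
    & level (joint z) (jset u) != 0].
Proof.
move=> Qz; rewrite inE /weight; case: ifP => [/andP[n1 n2]|]; last by rewrite eqxx.
move=> lu; have /level_neq0P := lu => /(_ (fun i => joint_ge0 i Qz))[pos _].
split=> //; apply/subsetP => v uv; rewrite inE.
  have := pos (inl v); rewrite inE => /(_ uv); apply: contraTneq => /= ->.
  by rewrite mul0r ltxx.
have := pos (inr v); rewrite inE => /(_ uv); apply: contraTneq => /= ->.
by rewrite mul0r ltxx.
Qed.

Lemma supp_weight z : gs_set Q z -> supp (weight z) \in gc_simp E.
Proof.
move=> Qz; have [[a0 _ aD] [b0 _ bD]] := Qz; rewrite inE; apply/and3P; split.
(* The pair of sets of maximizers has non-zero weight; both are non-empty because both maxima are
   scaled to 1. *)
- pose u : gc_vert E :=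
    ([set v | joint z (inl v) == 1], [set w | joint z (inr w) == 1]).
  have [v v0 vE] := maxnorm_attained a0 (gc_simp_neq0 aD).
  have [w w0 wE] := maxnorm_attained b0 (gc_simp_neq0 bD).
  apply/set0Pn; exists u; rewrite inE /weight ifT; last first.
    apply/andP; split; apply/set0Pn; [exists v|exists w]; rewrite inE /=.
      by rewrite vE divff // lt0r_neq0.
    by rewrite wE divff // lt0r_neq0.
  rewrite (_ : jset u = [set i | joint z i == 1]).
    by apply: level_top => i; apply: joint01.
  by apply/setP => -[?|?]; rewrite !inE.
- apply/subsetP => u /(supp_weightP Qz)[n1 n2 s1 s2 _]; rewrite inE.
  by rewrite (gc_simp_sub aD n1 s1) (gc_simp_sub bD n2 s2).
- apply/forall_inP => u /(supp_weightP Qz)[_ _ _ _ lu].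
  apply/forall_inP => u' /(supp_weightP Qz)[_ _ _ _ lu'].
  rewrite -!jset_sub; apply/orP.
  by apply: level_chain lu lu' => i; apply: joint_ge0.
Qed.

Lemma maxnorm_realact (D : gcomplex G) (x : gpoints R D) a :
  @maxnorm R (gc_vert D) (realact x a) = @maxnorm R (gc_vert D) x.
Proof.
by rewrite /maxnorm [RHS](reindex_inj (act_inj (gc_act D) a^-1%g)).
Qed.

Lemma weight_act z a u : a \in G ->
  weight (gs_act z a) u = weight z (gc_act E u a^-1%g).
Proof.
move=> Ga; rewrite /weight /= -!card_gt0 !card_setact; case: ifP => // _.
(* The action of [a^-1] on the disjoint union of the vertex sets. *)
pose f (i : V1 + V2) : V1 + V2 := match i with
  | inl v => inl (gc_act D1 v a^-1%g)
  | inr w => inr (gc_act D2 w a^-1%g)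
  end.
rewrite -(@level_reindex _ _ (joint z) f (jset u)).
- congr (level _ _); apply/funext => -[v|w] /=; by rewrite maxnorm_realact.
- by move=> [v|w] [v'|w'] //= [/act_inj->].
- by move=> [v|w]; rewrite !inE /= (mem_imset _ _ (act_inj _ _)).
Qed.

Definition pairing (z : Q) : gpoints R E := normalize (weight z).

Lemma smap_pairing : @smap gT G Q (rspace R E) pairing.
Proof.
have cfst v : @cont_on Q R (gs_set Q) (fun z => z.1 v).
  apply: (@cont_on_comp Q (gpoints R D1) R _ classical_sets.setT
    fst (fun x => x v)) => //.
    exact: cont_on_fst.
  exact: cont_on_coord.
have csnd w : @cont_on Q R (gs_set Q) (fun z => z.2 w).
  apply: (@cont_on_comp Q (gpoints R D2) R _ classical_sets.setT
    snd (fun x => x w)) => //.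
    exact: cont_on_snd.
  exact: cont_on_coord.
apply: (@smap_normalize R gT G Q E weight).
- move=> u; rewrite /weight.
  case: (_ && _); last exact: cont_on_cst.
  apply: (@cont_on_level R _ Q (gs_set Q) joint) => -[v|w] /=; apply: cont_on_div.
  + exact: cfst.
  + by apply: cont_on_bigmax => v' _; apply: cfst.
  + by move=> z [z1 _]; apply/lt0r_neq0/maxnorm_gt0.
  + exact: csnd.
  + by apply: cont_on_bigmax => v' _; apply: csnd.
  + by move=> z [_ z2]; apply/lt0r_neq0/maxnorm_gt0.
- move=> z u Qz; rewrite /weight; case: ifP => // _.
  by apply: level_ge0 => i; apply: joint_ge0.
- exact: supp_weight.
- by move=> z a u _; apply: weight_act.
Qed.

(** A pair of non-zero weight consists of subsets of the two supports, and spreading only returns to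
    those subsets. *)
Lemma supp_prodc_fst_pairing z : gs_set Q z ->
  supp (prodc_fst (pairing z)) \subset supp z.1.
Proof.
move=> Qz; have [_ /(_ z Qz)[y0 _ _] _] := smap_pairing.
apply: subset_trans (supp_normalize _) _; rewrite supp_spread //.
apply/bigcupsP => u /(subsetP (supp_normalize _)).
by case/(supp_weightP Qz).
Qed.

Lemma supp_prodc_snd_pairing z : gs_set Q z ->
  supp (prodc_snd (pairing z)) \subset supp z.2.
Proof.
move=> Qz; have [_ /(_ z Qz)[y0 _ _] _] := smap_pairing.
apply: subset_trans (supp_normalize _) _; rewrite supp_spread //.
apply/bigcupsP => u /(subsetP (supp_normalize _)).
by case/(supp_weightP Qz).
Qed.

(* If some w lies in all the k u, then spread k x has maximum 1, and dividing
   by the maximum undoes the normalization. *)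
Lemma normalize_maxnorm_spread (D : gcomplex G)
    (k : gc_vert E -> {set gc_vert D}) x v :
  realization R E x ->
  (exists w, forall u, u \in supp x -> w \in k u) ->
  normalize (spread k x) v / @maxnorm R (gc_vert D) (normalize (spread k x)) =
  spread k x v.
Proof.
move=> [x0 x1 xE] [w kw].
have s0 v' : 0 <= spread k x v' by apply: sumr_ge0.
have s1 v' : spread k x v' <= 1.
  rewrite -x1 /spread big_mkcond /=; apply: ler_sum => u _; case: ifP => // _.
have sw : spread k x w = 1.
  rewrite -x1 /spread big_mkcond; apply: eq_bigr => u _; case: ifPn => // nku.
  by apply/esym/eqP/negPn/negP => xu; have := kw u; rewrite (negbTE nku) inE => /(_ xu).
have S0 : 0 < \sum_v' spread k x v'.
  by apply: sum_supp_gt0 => //; apply/set0Pn; exists w; rewrite inE sw oner_neq0.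
rewrite (@maxnormE _ _ _ w) /normalize.
- by rewrite sw div1r invrK divfK // lt0r_neq0.
- by rewrite divr_ge0 // ltW.
- by move=> v'; rewrite ler_pM2r ?invr_gt0 // sw.
Qed.

(** Dual to [prodc_top]. The vertices of the least pair lie in every pair of the chain, which
    supplies the common vertex for [normalize_maxnorm_spread]. *)
Lemma prodc_bot C : C \in gc_simp E ->
  exists2 t : gc_vert E, t \in C & forall u, u \in C -> prod_le t u.
Proof.
rewrite inE => /and3P[/set0Pn[u0 Cu0] _ chC].
case: (@arg_minnP _ u0 [in C] (fun u => #|u.1| + #|u.2|)%N Cu0) => t Ct tmin.
exists t => // u Cu; have le : (#|t.1| + #|t.2| <= #|u.1| + #|u.2|)%N := tmin u Cu.
case/orP: (forall_inP (forall_inP chC u Cu) t Ct) => // ut.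
suff -> : t = u by apply/andP.
apply/esym/(prod_le_card ut); apply/eqP; rewrite eqn_leq le andbT.
by case/andP: ut => s1 s2; rewrite leq_add ?subset_leq_card.
Qed.

(** After rescaling, the joint function is the combination, with coefficients [x u], of the
    indicator functions of the sets [jset u]. These form a chain on the support of [x], so
    [level_combination] applies. *)
Lemma supp_pairing_proj x : realization R E x ->
  supp (pairing (prodc_fst x, prodc_snd x)) \subset supp x.
Proof.
move=> Ex; have [x0 x1 xE] := Ex.
have Qz : gs_set Q (prodc_fst x, prodc_snd x).
  by split; [have [_ + _] := smap_prodc_fst; apply|
    have [_ + _] := smap_prodc_snd; apply].
have [t xt tmin] := prodc_bot xE; have [t1 t2] := prodc_mem xE xt.
have /set0Pn[v tv] := gc_simp_neq0 t1; have /set0Pn[w tw] := gc_simp_neq0 t2.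
have jE : joint (prodc_fst x, prodc_snd x) = fun i => \sum_(u | i \in jset u) x u.
  apply/funext => -[v'|w'] /=; rewrite normalize_maxnorm_spread //.
  - by apply: eq_bigl => u; rewrite inE.
  - by exists v => u /tmin/andP[/subsetP-> //].
  - by apply: eq_bigl => u; rewrite inE.
  - by exists w => u /tmin/andP[_ /subsetP-> //].
apply/subsetP => u /(subsetP (supp_normalize _))/(supp_weightP Qz)[n1 _ _ _].
rewrite jE => lu; have [||u' xu' /jset_inj <- //] := level_combination x0 _ _ lu.
  move=> u1 u2 xu1 xu2; rewrite !jset_sub; apply/orP.
  move: xE; rewrite inE => /and3P[_ _ chx].
  exact: (forall_inP (forall_inP chx u1 xu1) u2 xu2).
by have /set0Pn[i ui] := n1; apply/set0Pn; exists (inl i); rewrite inE.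
Qed.

Lemma sequiv_prodc : sequiv R G (rspace R E) Q.
Proof.
exists (fun x => (prodc_fst x, prodc_snd x)), pairing.
have mp := smap_pairing; have m1 := smap_prodc_fst; have m2 := smap_prodc_snd.
have m12 := smap_pair m1 m2.
split=> //.
- apply: (@shomotopic_line R gT G (rspace R E) E).
  + exact: smap_comp m12 mp.
  + exact: smap_id.
  + move=> x Ex /=; have [_ _ xE] := Ex.
    by rewrite (setUidPr (supp_pairing_proj Ex)).
- rewrite (_ : id = (fun z : Q => (z.1, z.2))); last by apply/funext => -[].
  apply: (@shomotopic_pair R gT G Q (rspace R D1) (rspace R D2)
    (fun z => prodc_fst (pairing z)) fst (fun z => prodc_snd (pairing z)) snd).
  + apply: (@shomotopic_line R gT G Q D1); first exact: smap_comp mp m1.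
      exact: smap_fst.
    move=> z Qz; have [[_ _ zD] _] := Qz.
    by rewrite (setUidPr (supp_prodc_fst_pairing Qz)).
  + apply: (@shomotopic_line R gT G Q D2); first exact: smap_comp mp m2.
      exact: smap_snd.
    move=> z Qz; have [_ [_ _ zD]] := Qz.
    by rewrite (setUidPr (supp_prodc_snd_pairing Qz)).
Qed.

End ProductRealization.

(** * Synthetic parts, fixed subcomplexes and products of synthetic buildings *)

Section SyntheticBuildingProducts.
Local Open Scope ring_scope.
Variables (R : realType) (p : nat) (gT : finGroupType) (G : {group gT}).
Hypothesis p_pr : prime p.
Implicit Types D E : gcomplex G.

(** Setwise stabilizers of simplices fix them pointwise, so an element preserving the support cannot
    permute the weights. *)
Lemma realact_stab D x a : realization R D x -> a \in G ->
  (realact x a = x) <-> a \in ('N_G(supp x | gc_act D))%g.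
Proof.
move=> [_ _ xD] Ga; split=> [xa|/(subsetP (gc_simp_stab xD))/setIP[_ Ca]].
  apply/setIP; split=> //; rewrite !inE Ga /=; apply/subsetP => v.
  rewrite !inE => xv; rewrite -xa /realact actKin //.
have Cva v : v \in supp x -> gc_act D v a = v by apply: (astab_act Ca).
apply/funext => v; rewrite /realact.
have [xv|xv] := boolP (v \in supp x); first by rewrite -{1}(Cva v xv) actKin.
(* Were the translate of [v] by [a^-1] in the support, [a] would fix it, and it would equal [v],
   which is outside. *)
have [xva|] := boolP (gc_act D v a^-1%g \in supp x).
  by have := Cva _ xva; rewrite actKVin // => e; rewrite -e in xva; rewrite xva in xv.
by rewrite inE negbK => /eqP->; move: xv; rewrite inE negbK => /eqP->.
Qed.

(** The two sets of points are equal, by Cauchy's theorem in one direction and Lagrange's in the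
    other. *)
Lemma sequiv_SB D : sequiv R G (rspace R (SB p D)) (psing G p (rspace R D)).
Proof.
apply: sequiv_eqset; apply/seteqP; split=> x.
  move=> [x0 x1 /setIdP[xD]] /(Cauchy p_pr)[a Na pa].
  have Dx : realization R D x by [].
  have Ga : a \in G by case/setIP: Na.
  by split=> //; exists a; split=> //; apply/(realact_stab Dx Ga).
move=> [Dx [a [Ga pa xa]]]; have [x0 x1 xD] := Dx; split=> //.
apply/setIdP; split=> //.
by rewrite -pa order_dvdG //; apply/(realact_stab Dx Ga).
Qed.

Lemma ghequivE (H : {group gT}) (D E : gcomplex H) :
  ghequiv R D E = sequiv R H (rspace R D) (rspace R E).
Proof. by []. Qed.

Lemma ghequiv_refl D : ghequiv R D D.
Proof. by rewrite ghequivE; apply: sequiv_refl. Qed.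

Lemma ghequiv_sym D E : ghequiv R D E -> ghequiv R E D.
Proof. by rewrite !ghequivE; apply: sequiv_sym. Qed.

Lemma ghequiv_trans D E F : ghequiv R D E -> ghequiv R E F -> ghequiv R D F.
Proof. by rewrite !ghequivE; apply: sequiv_trans. Qed.

Lemma SB_synthetic_simp D : synthetic R p D -> gc_simp (SB p D) = gc_simp D.
Proof.
by move=> [_ hD]; apply/setP => s; rewrite inE andb_idr //; apply: hD.
Qed.

Lemma sequiv_SB_synthetic D :
  synthetic R p D -> sequiv R G (rspace R (SB p D)) (rspace R D).
Proof.
move=> sD; apply: sequiv_eqset; rewrite /realization.
by rewrite [gc_simp (SB p D)](SB_synthetic_simp sD).
Qed.

(** The stabilizer of a simplex fixed by [P] contains [P], so its order is divisible by [p]: passing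
    to [SB] leaves the fixed subcomplexes unchanged. *)
Lemma weak_synthetic_SB D :
  weak_synthetic R p D -> weak_synthetic R p (SB p D).
Proof.
move=> wD P sPG pP P1.
suff e : gc_simp (fixc (SB p D) sPG) = gc_simp (fixc D sPG).
  rewrite /gcontractible ghequivE.
  apply: (@sequiv_trans R _ 'N_G(P)%G _ (rspace R (fixc D sPG))); last exact: wD.
  apply: sequiv_eqset; rewrite /realization.
  by rewrite [gc_simp (fixc (SB p D) sPG)]e.
apply/setP => s; rewrite !inE; apply/andP/andP => [[/andP[]]|[Ds fs]] //.
rewrite Ds /=; split=> //.
have pP' : (p %| #|P|)%N by have [_ + _] := pgroup_pdiv pP P1.
apply: dvdn_trans pP' (cardSg _); rewrite subsetI sPG /=.
apply: subset_trans (astab_sub _ _); apply/subsetP => a Pa.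
rewrite !inE (subsetP sPG) //=; apply/subsetP => v /(subsetP fs)/afixP/(_ a Pa) va.
by rewrite inE va.
Qed.

Lemma SB_synthetic D : weak_synthetic R p D -> synthetic R p (SB p D).
Proof.
by move=> wD; split; [apply: weak_synthetic_SB|move=> s /setIdP[]].
Qed.

Lemma rspace_gpoint (H : {group gT}) (y : gpoints R (gpoint H)) :
  realization R (gpoint H) y <-> y = (fun=> 1).
Proof.
split=> [[_ + _]|->].
  rewrite (big_pred1 tt) => [y1|[]//]; by apply/funext => -[].
split=> [//||]; first by rewrite (big_pred1 tt) => // -[].
by apply/set1P/setP => -[]; rewrite !inE oner_neq0.
Qed.

Lemma sequiv_prods_gpoint (H : {group gT}) (X : gspace gT) :
  sequiv R H (prods X (rspace R (gpoint H))) X.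
Proof.
apply: (@sequiv_prods1 _ _ _ X (rspace R (gpoint H)) (fun=> 1)) => //.
by apply/seteqP; split=> y /rspace_gpoint.
Qed.

(** A pair is fixed by [P] when both components are preserved as sets; for simplices of a G-complex
    this means that they are fixed pointwise. *)
Lemma prodc_fix_simp D1 D2 (P : {group gT}) (sPG : P \subset G) :
  gc_simp (fixc (prodc D1 D2) sPG) =
  gc_simp (prodc (fixc D1 sPG) (fixc D2 sPG)).
Proof.
have fixE D (s : {set gc_vert D}) : s \in gc_simp D ->
    (s \subset 'Fix_(gc_act D)(P))%g = [forall a in P, ((gc_act D)^*)%act s a == s].
  move=> Ds; apply/subsetP/forall_inP => [fs a Pa|fs v sv].
    apply/eqP/setP => v; rewrite in_setact ?(subsetP sPG) //.
    apply/idP/idP => [sva|sv].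
      by have /afixP/(_ a Pa) := fs _ sva; rewrite actKVin ?(subsetP sPG) // => ->.
    by have /afixP/(_ a^-1%g) -> := fs _ sv; rewrite ?groupV.
  apply/afixP => a Pa; have Ga := subsetP sPG a Pa.
  have : a \in ('N_G(s | gc_act D))%g.
    rewrite !inE Ga /=; apply/subsetP => w sw.
    by rewrite inE -(eqP (fs a Pa)); apply: mem_setact.
  by move=> /(subsetP (gc_simp_stab Ds))/setIP[_ Ca]; apply: astab_act Ca sv.
(* The chain condition is the same on both sides, so only the admissible vertices of the product are
   compared. *)
suff AE : setX (gc_simp D1) (gc_simp D2) :&: 'Fix_(gc_act (prodc D1 D2))(P)%g =
    setX (gc_simp (fixc D1 sPG)) (gc_simp (fixc D2 sPG)).
  apply/setP => C; rewrite !inE -AE subsetI -!andbA; congr (_ && (_ && _)).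
  exact: andbC.
apply/setP => -[s t]; rewrite inE !in_setX !inE.
have [Ds|_] /= := boolP (s \in gc_simp D1); last by [].
have [Dt|_] /= := boolP (t \in gc_simp D2); last by rewrite andbF.
rewrite (fixE _ _ Ds) (fixE _ _ Dt).
apply/subsetP/andP => [fst|[/forall_inP fs /forall_inP ft] a Pa].
  split; apply/forall_inP => a /fst; rewrite inE => /eqP[es et]; apply/eqP.
    exact: es.
  exact: et.
by rewrite inE; apply/eqP; congr (_, _); apply/eqP; [apply: fs|apply: ft].
Qed.

Lemma weak_synthetic_prodc D1 D2 :
  weak_synthetic R p D1 -> weak_synthetic R p D2 ->
  weak_synthetic R p (prodc D1 D2).
Proof.
move=> w1 w2 P sPG pP P1; rewrite /gcontractible ghequivE.
set H := ('N_G(P))%G; set F1 := fixc D1 sPG; set F2 := fixc D2 sPG.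
have e : sequiv R H (rspace R (fixc (prodc D1 D2) sPG)) (rspace R (prodc F1 F2)).
  by apply: sequiv_eqset; rewrite /realization [gc_simp _]prodc_fix_simp.
apply: sequiv_trans e _; apply: sequiv_trans (sequiv_prodc _ _ _) _.
apply: sequiv_trans (sequiv_prods_gpoint H _).
by apply: sequiv_prods; [apply: w1|apply: w2].
Qed.

Lemma SB_prodc_synthetic D1 D2 :
  synthetic R p D1 -> synthetic R p D2 -> synthetic R p (SB p (prodc D1 D2)).
Proof. by move=> [w1 _] [w2 _]; apply/SB_synthetic/weak_synthetic_prodc. Qed.

Lemma sequiv_SB_prodc D1 D2 :
  sequiv R G (rspace R (SB p (prodc D1 D2)))
    (psing G p (prods (rspace R D1) (rspace R D2))).
Proof. by apply: sequiv_trans (sequiv_SB _) _; apply/sequiv_psing/sequiv_prodc. Qed.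

Lemma ghequiv_SB_prodc D1 D2 E1 E2 : ghequiv R D1 E1 -> ghequiv R D2 E2 ->
  ghequiv R (SB p (prodc D1 D2)) (SB p (prodc E1 E2)).
Proof.
rewrite !ghequivE => e1 e2; apply: sequiv_trans (sequiv_SB_prodc _ _) _.
apply: sequiv_trans (sequiv_sym (sequiv_SB_prodc _ _)).
exact/sequiv_psing/sequiv_prods.
Qed.

(** The inner singular part is absorbed by the outer one, so both sides reduce to the singular part
    of a triple product of spaces. *)
Lemma ghequiv_SB_prodcA D1 D2 D3 :
  ghequiv R (SB p (prodc D1 (SB p (prodc D2 D3))))
            (SB p (prodc (SB p (prodc D1 D2)) D3)).
Proof.
rewrite ghequivE; apply: sequiv_trans (sequiv_SB_prodc _ _) _.
apply: sequiv_trans (sequiv_sym (sequiv_SB_prodc _ _)).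
apply: (@sequiv_trans R _ G _ (psing G p
  (prods (rspace R D1) (prods (rspace R D2) (rspace R D3))))).
  apply: sequiv_trans (sequiv_psing_prodsr _ _ _ _ _); apply: sequiv_psing.
  by apply: sequiv_prods (sequiv_refl _ _ _) (sequiv_SB_prodc _ _).
apply: (@sequiv_trans R _ G _ (psing G p
  (prods (prods (rspace R D1) (rspace R D2)) (rspace R D3)))).
  exact/sequiv_psing/sequiv_prodsA.
apply: sequiv_sym; apply: sequiv_trans (sequiv_psing_prodsl _ _ _ _ _).
apply: sequiv_psing.
by apply: sequiv_prods (sequiv_SB_prodc _ _) (sequiv_refl _ _ _).
Qed.

(** The point drops out of the product of spaces, leaving the singular part of [D], which is all of
    [D] as [D] is synthetic. *)
Lemma ghequiv_SB_prodc_gpointr D :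
  synthetic R p D -> ghequiv R (SB p (prodc D (gpoint G))) D.
Proof.
move=> sD; rewrite ghequivE; apply: sequiv_trans (sequiv_SB_prodc _ _) _.
apply: sequiv_trans (sequiv_SB_synthetic sD).
apply: sequiv_trans (sequiv_sym (sequiv_SB D)).
exact/sequiv_psing/sequiv_prods_gpoint.
Qed.

Lemma ghequiv_SB_prodc_gpointl D :
  synthetic R p D -> ghequiv R (SB p (prodc (gpoint G) D)) D.
Proof.
move=> sD; rewrite ghequivE.
apply: (@sequiv_trans R _ G _ (rspace R (SB p (prodc D (gpoint G))))); last first.
  exact: ghequiv_SB_prodc_gpointr.
apply: sequiv_trans (sequiv_SB_prodc _ _) _.
apply: sequiv_trans (sequiv_sym (sequiv_SB_prodc _ _)).
exact/sequiv_psing/sequiv_prodsC.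
Qed.

(** The stabilizer of the only simplex is [G], whence the divisibility condition on its order. *)
Lemma synthetic_gpoint : (p %| #|G|)%N -> synthetic R p (gpoint G).
Proof.
move=> pG; split=> [P sPG pP P1|s /set1P->].
  have e : gc_simp (fixc (gpoint G) sPG) = gc_simp (gpoint 'N_G(P)%G).
    apply/setP => s; rewrite inE andb_idr // => _.
    by apply/subsetP => v _; apply/afixP => a.
  rewrite /gcontractible ghequivE; apply: sequiv_eqset.
  by rewrite /realization [gc_simp (fixc _ _)]e.
rewrite (_ : 'N_G(_ | _)%g = G) //; apply/setIidPl/subsetP => a Ga.
by rewrite !inE Ga /=; apply/subsetP => v; rewrite !inE.
Qed.

(** * The operation on equivariant homotopy classes *)

Implicit Types c : shclass R p G.

Lemma shclass_synthetic c D : c D -> synthetic R p D.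
Proof. by case: c => m /= [D0 _ mP] /mP[]. Qed.

Lemma shclass_ghequiv c D E : c D -> c E -> ghequiv R D E.
Proof.
case: c => m /= [D0 _ mP] /mP[_ e1] /mP[_ e2].
exact: ghequiv_trans (ghequiv_sym e1) e2.
Qed.

Lemma shclass_rep c : exists D, c D.
Proof.
case: c => m /= [D sD mP]; exists D; apply/mP; split=> //; exact: ghequiv_refl.
Qed.

(** Equivalent representatives give the same members by transitivity; equality of the records then
    follows from extensionality and proof irrelevance. *)
Lemma shclass_eq c c' D D' : c D -> c' D' -> ghequiv R D D' -> c = c'.
Proof.
case: c c' => [m mh] [m' mh'] /= mD mD' e.
suff em : m = m' by subst m'; congr ShClass; apply: Prop_irrelevance.
apply/funext => E; apply/propext.
case: mh mh' => [D0 _ mP] [D0' _ mP'].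
have [_ e0] := (mP D).1 mD; have [_ e0'] := (mP' D').1 mD'.
have e00 : ghequiv R D0 D0'.
  exact: ghequiv_trans e0 (ghequiv_trans e (ghequiv_sym e0')).
split=> [/mP[sE h]|/mP'[sE h]]; [apply/mP'|apply/mP]; split=> //.
  exact: ghequiv_trans (ghequiv_sym e00) h.
exact: ghequiv_trans e00 h.
Qed.

Definition shclass_of D (sD : synthetic R p D) : shclass R p G :=
  ShClass (ex_intro2 _ _ D sD (fun E => iff_refl _)).

(** The product class is described through all pairs of representatives, without choosing any;
    [ghequiv_SB_prodc] shows that they all yield one class. *)
Lemma shop_subproof c1 c2 : exists2 D, synthetic R p D & forall E,
  (exists D1 D2, [/\ c1 D1, c2 D2, synthetic R p E &
     ghequiv R (SB p (prodc D1 D2)) E]) <-> synthetic R p E /\ ghequiv R D E.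
Proof.
have [D1 c1D] := shclass_rep c1; have [D2 c2D] := shclass_rep c2.
exists (SB p (prodc D1 D2)).
  by apply: SB_prodc_synthetic; [exact: shclass_synthetic c1D|
    exact: shclass_synthetic c2D].
move=> E; split=> [[E1 [E2 [c1E c2E sE e]]]|[sE e]]; last by exists D1, D2.
split=> //; apply: ghequiv_trans e; apply: ghequiv_SB_prodc.
  exact: shclass_ghequiv c1D c1E.
exact: shclass_ghequiv c2D c2E.
Qed.

Definition shop c1 c2 : shclass R p G := ShClass (shop_subproof c1 c2).

Lemma shop_mem c1 c2 D1 D2 :
  c1 D1 -> c2 D2 -> shop c1 c2 (SB p (prodc D1 D2)).
Proof.
move=> c1D c2D; exists D1, D2; split=> //; last exact: ghequiv_refl.
apply: SB_prodc_synthetic; first exact: shclass_synthetic c1D.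
exact: shclass_synthetic c2D.
Qed.

Lemma shopA : associative shop.
Proof.
move=> c1 c2 c3; have [D1 m1] := shclass_rep c1.
have [D2 m2] := shclass_rep c2; have [D3 m3] := shclass_rep c3.
apply: shclass_eq (ghequiv_SB_prodcA D1 D2 D3).
  exact/shop_mem/shop_mem.
by apply: shop_mem => //; apply: shop_mem.
Qed.

End SyntheticBuildingProducts.

Theorem proposition7p11 (R : realType) (gT : finGroupType) (G : {group gT})
    (p : nat) (p_pr : prime p) :
  (forall D1 D2 : gcomplex G,
     weak_synthetic R p D1 -> weak_synthetic R p D2 ->
     weak_synthetic R p (prodc D1 D2) /\
     synthetic R p (SB p (prodc D1 D2))) /\
  (exists op : shclass R p G -> shclass R p G -> shclass R p G,
     (forall (c1 c2 : shclass R p G) (D1 D2 : gcomplex G),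
        c1 D1 -> c2 D2 -> op c1 c2 (SB p (prodc D1 D2))) /\
     associative op /\
     (p %| #|G| -> exists e : shclass R p G,
        e (gpoint G) /\ left_id e op /\ right_id e op)).
Proof.
split=> [D1 D2 w1 w2|].
  have w := weak_synthetic_prodc w1 w2.
  by split=> //; apply: SB_synthetic.
exists (shop p_pr); split; first by move=> *; apply: shop_mem.
split=> [|pG]; first exact: shopA.
have e1 : shclass_of (synthetic_gpoint R pG) (gpoint G).
  by split; [apply: synthetic_gpoint|apply: ghequiv_refl].
exists (shclass_of (synthetic_gpoint R pG)); split=> //.
split=> c; have [D cD] := shclass_rep c; have sD := shclass_synthetic cD.
  exact: shclass_eq (shop_mem p_pr e1 cD) cD (ghequiv_SB_prodc_gpointl p_pr sD).
exact: shclass_eq (shop_mem p_pr cD e1) cD (ghequiv_SB_prodc_gpointr p_pr sD).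
Qed.
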